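(* Let $X$ be a uniformly convex Banach space with dual $X^*$ and let $(x_k)_{k\geq 1}$ be a Cesaro shift-bounded sequence in $X$. Then the following conditions are equivalent: (i) $(x_k)_{k\geq1}$ is weakly mixing to zero, that is $$\lim_{n\to\infty}\frac 1n\sum_{k=1}^n|\langle x^*,x_k\rangle|=0\quad\text{for all }x^*\in X^*.$$ (j) $(x_k)_{k\geq 1}$ is uniformly weakly mixing to zero, that is $$\lim_{n\to\infty}\ \sup\Big\{\frac 1n\sum_{k=1}^n|\langle x^*,x_k\rangle|\ ;\ x^*\in X^*,\ \|x^*\|\leq 1\Big\}=0.$$ (jw) $$\lim_{a,b\in\mathbb N^*,\ b-a\to\infty}\ \sup\Big\{\frac 1{b-a+1}\sum_{k=a}^b|\langle x^*,x_k\rangle|\ ;\ x^*\in X^*,\ \|x^*\|\leq 1\Big\}=0.$$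
   Context: $\mathbb N^*=\{1,2,\ldots\}$. Banach spaces are real or complex. A sequence $(x_k)_{k\ge1}$ in a Banach space is Cesaro shift-bounded if there exists a constant $c>0$ such that $$\Big\|\sum_{j=1}^p x_{n_j+n}\Big\|\leq c\,\Big\|\sum_{j=1}^p x_{n_j}\Big\|,\qquad n\geq 1,$$ for any $p\in\mathbb N^*$ and $n_1,\ldots,n_p\in\mathbb N^*$ with $n_1<\ldots<n_p$. *)

(* Defs.v *)
From HB Require Import structures.
From mathcomp Require Import all_boot all_order all_algebra.
From mathcomp Require Import complex.
From mathcomp Require Import all_classical all_reals all_analysis.

Set Implicit Arguments.
Unset Strict Implicit.
Unset Printing Implicit Defensive.

Import Order.TTheory GRing.Theory Num.Theory.
Import numFieldNormedType.Exports.

Local Open Scope classical_set_scope.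
Local Open Scope ring_scope.

(* Banach spaces are real or complex: [scalars R k] is the field [R] of real
   numbers or the field [R[i]] of complex numbers, depending on [k]. *)
Variant scalar_kind := RealScalars | ComplexScalars.

Definition scalars (R : realType) (k : scalar_kind) : numFieldType :=
  match k with
  | RealScalars => R : numFieldType
  | ComplexScalars => complex R : numFieldType
  end.

Definition scalar_re (R : realType) (k : scalar_kind) : scalars R k -> R :=
  match k return scalars R k -> R with
  | RealScalars => fun z => z
  | ComplexScalars => fun z => complex.Re z
  end.

(* The norm of a [normedModType K] takes its values in [K]. For [K = R[i]] these
   values are nonnegative reals embedded in [R[i]]; [rnorm] reads them in [R],
   where suprema are available. *)
Definition rnorm (R : realType) (k : scalar_kind)
  (V : normedModType (scalars R k)) (v : V) : R := scalar_re `|v|.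

Section banach.
Context (R : realType) (k : scalar_kind).
Local Notation K := (scalars R k).
Variable X : completeNormedModType K.

Definition uniformly_convex : Prop :=
  forall e : R, 0 < e <= 2 -> exists2 d : R, 0 < d &
    forall x y : X, rnorm x = 1 -> rnorm y = 1 -> e <= rnorm (x - y) ->
      rnorm (2^-1 *: (x + y)) <= 1 - d.

Definition dual : set {linear X -> K^o} := [set f | continuous f].

Definition dual_norm (f : {linear X -> K^o}) : R :=
  sup [set rnorm (f x) | x in [set x : X | rnorm x <= 1]].

Definition dual_ball : set {linear X -> K^o} :=
  dual `&` [set f | dual_norm f <= 1].

(* Sequences are indexed by the integers >= 1: the value at index 0 of
   [x : nat -> X] is never used below. *)
Implicit Type x : nat -> X.

Definition cesaro_shift_bounded x : Prop :=
  exists2 c : R, 0 < c &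
    forall (p : nat) (m : 'I_p -> nat), (0 < p)%N ->
      (forall j, 0 < m j)%N -> {homo m : i j / (i < j)%N} ->
      forall n : nat, (0 < n)%N ->
        rnorm (\sum_(j < p) x (m j + n)%N) <= c * rnorm (\sum_(j < p) x (m j)).

Definition weakly_mixing_to_zero x : Prop :=
  forall f, dual f ->
    (n%:R^-1 * \sum_(1 <= i < n.+1) rnorm (f (x i))) @[n --> \oo] --> (0 : R).

Definition uniformly_weakly_mixing_to_zero x : Prop :=
  sup [set n%:R^-1 * \sum_(1 <= i < n.+1) rnorm (f (x i)) | f in dual_ball]
    @[n --> \oo] --> (0 : R).

(* The filter on pairs [(a, b)] of integers >= 1 expressing [b - a --> oo]. *)
Definition gap_infty : set_system (nat * nat) :=
  filter_from [set: nat]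
    (fun N => [set ab | (0 < ab.1)%N /\ (ab.1 + N <= ab.2)%N]).

Definition window_uniformly_weakly_mixing_to_zero x : Prop :=
  sup [set (ab.2%:R - ab.1%:R + 1)^-1 *
             \sum_(ab.1 <= i < ab.2.+1) rnorm (f (x i)) | f in dual_ball]
    @[ab --> gap_infty] --> (0 : R).

End banach.

(* Main.v *)
(* The implication from (i) to (jw) is the substance. For functionals of norm at
   most 1 the averages of |f (x i)| over a window are controlled by the norms of
   the sums of x over subsets A of that window, so it suffices to show that
   these norms are o(length of the window).
   By (i) and Kakutani's proof of the Banach-Saks property, every set D of
   integers that has density at least e on all long enough initial segments
   contains a block s of 2^q integers with |sum_s x| <= th^q 2^q M, where th < 1
   comes from uniform convexity. If A has density at least 2e in its window, a
   suitable left translate of A is such a set D, and shift-boundedness carries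
   the estimate for s to its translate inside A. Removing such blocks from A one
   after the other leaves a set of small density, whose sum is trivially small. *)

Require Import Defs.
From HB Require Import structures.
From mathcomp Require Import all_boot all_order all_algebra.
From mathcomp Require Import complex.
From mathcomp Require Import ring lra zify.
From mathcomp Require Import all_classical all_reals all_analysis.

Set Implicit Arguments.
Unset Strict Implicit.
Unset Printing Implicit Defensive.

Import Order.TTheory GRing.Theory Num.Theory.
Import numFieldNormedType.Exports.

Local Open Scope classical_set_scope.
Local Open Scope ring_scope.

(** * Norming functionals *)

Section hahn_banach.
Context (R : realType) (K : nzRingType) (V : lmodType K).
Variable rs : {rmorphism R -> K}.
Implicit Types p q : V -> R.

(** Reals act on [V] through [rs], so that real and complex spaces are treated together. Homogeneity
    is an inequality here; using it at [t^-1] as well gives the equality [sublinearZ]. *)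
Definition sublinear p :=
  (forall x y, p (x + y) <= p x + p y) /\
  (forall t x, 0 < t -> p (rs t *: x) <= t * p x).

Lemma sublinear0 p : sublinear p -> p 0 = 0.
Proof.
move=> [pD pZ]; have := pD 0 0; have := pZ 2^-1 0 ltac:(by rewrite invr_gt0).
by rewrite scaler0 addr0; lra.
Qed.

Lemma sublinear_opp p x : sublinear p -> - p (- x) <= p x.
Proof.
by move=> sp; have := (proj1 sp) x (- x); rewrite subrr sublinear0 //; lra.
Qed.

Lemma sublinearZ p t x : sublinear p -> 0 <= t -> p (rs t *: x) = t * p x.
Proof.
move=> sp; rewrite le_eqVlt => /orP[/eqP<-|t0].
  by rewrite rmorph0 scale0r mul0r sublinear0.
apply/eqP; rewrite eq_le (proj2 sp) //=.
have := (proj2 sp) t^-1 (rs t *: x) ltac:(by rewrite invr_gt0).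
rewrite scalerA -rmorphM mulVf ?gt_eqF// rmorph1 scale1r => h.
by rewrite -ler_pdivlMl.
Qed.

(* The largest sublinear functional below [p] whose value at [- a] is at most [- p a]. *)
Let tilt p a x := inf [set p (x + rs t *: a) - t * p a | t in [set t | 0 <= t]].

(** The bound is uniform in [t], which makes the infimum defining [tilt] a genuine one. *)
Let tilt_lb p a x t : sublinear p -> 0 <= t ->
  - p (- x) <= p (x + rs t *: a) - t * p a.
Proof.
move=> sp t0; have := (proj1 sp) (- x) (x + rs t *: a).
by rewrite addKr (sublinearZ _ sp)//; lra.
Qed.

Let tilt_le p a x t : sublinear p -> 0 <= t ->
  tilt p a x <= p (x + rs t *: a) - t * p a.
Proof.
move=> sp t0; apply: ge_inf; last by exists t.
by exists (- p (- x)) => _ [s s0 <-]; exact: tilt_lb.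
Qed.

Let tilt_ge p a x b :
  (forall t, 0 <= t -> b <= p (x + rs t *: a) - t * p a) -> b <= tilt p a x.
Proof.
move=> h; apply: lb_le_inf; last by move=> _ [t t0 <-]; exact: h.
by exists (p (x + rs 0 *: a) - 0 * p a); exists 0 => /=.
Qed.

Let tilt_sublinear p a : sublinear p -> sublinear (tilt p a).
Proof.
move=> sp; split=> [x y|t x t0].
  rewrite -lerBlDr; apply: tilt_ge => t t0.
  rewrite lerBlDr [leRHS]addrC -lerBlDr; apply: tilt_ge => s s0.
  have := @tilt_le p a (x + y) (s + t) sp (addr_ge0 s0 t0).
  have := (proj1 sp) (x + rs t *: a) (y + rs s *: a).
  by rewrite rmorphD scalerDl addrACA [rs t *: a + _]addrC; lra.
rewrite -ler_pdivrMl//; apply: tilt_ge => s s0.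
rewrite ler_pdivrMl//.
have := @tilt_le p a (rs t *: x) (t * s) sp (mulr_ge0 (ltW t0) s0).
rewrite rmorphM -scalerA -scalerDr (sublinearZ _ sp (ltW t0)); lra.
Qed.

Let tilt_below p a x : sublinear p -> tilt p a x <= p x.
Proof.
move=> sp; have := @tilt_le p a x 0 sp (lexx _).
by rewrite rmorph0 scale0r addr0 mul0r subr0.
Qed.

Let tilt_opp p a : sublinear p -> tilt p a (- a) <= - p a.
Proof.
move=> sp; have := @tilt_le p a (- a) 1 sp ler01.
by rewrite rmorph1 scale1r addNr mul1r sublinear0// sub0r.
Qed.

(* A pointwise minimal sublinear functional equals all its tilts, hence is odd. *)
Lemma minimal_sublinear p : sublinear p -> exists g : V -> R,
  [/\ forall x y, g (x + y) = g x + g y, forall t x, g (rs t *: x) = t * g x &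
      forall x, g x <= p x].
Proof.
move=> sp.
pose T := {q : V -> R | sublinear q /\ forall x, q x <= p x}.
(* The order is reversed: a maximal element for Zorn is a pointwise minimal functional. *)
pose le (s t : T) := `[< forall x, sval t x <= sval s x >].
have [|||A Atot|g gmin] := @Zorn T le.
- by move=> s; apply/asboolP.
- move=> r s t /asboolP rs' /asboolP st; apply/asboolP => x.
  exact: le_trans (st x) (rs' x).
- move=> [s ?] [t ?] /asboolP st /asboolP ts; apply: eq_exist.
  by apply/funext => x; apply/eqP; rewrite eq_le st ts.
- have [A0|/set0P[q0 Aq0]] := eqVneq A set0.
    exists (exist _ p (conj sp (fun x => lexx _))).
    by move=> s; rewrite A0.
  (* The chain is bounded by its pointwise infimum, which is finite because every member is at least
     [- p (- x)] at [x]. *)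
  pose m x := inf [set sval q x | q in (A : set T)].
  have mle x (q : T) : A q -> m x <= sval q x.
    move=> Aq; apply: ge_inf; last by exists q.
    exists (- p (- x)) => _ [r _ <-]; case: r => r [sr rp] /=.
    by apply: le_trans (sublinear_opp _ sr); rewrite lerN2.
  have gem x b : (forall q : T, A q -> b <= sval q x) -> b <= m x.
    move=> h; apply: lb_le_inf; first by exists (sval q0 x); exists q0.
    by move=> _ [q Aq <-]; exact: h.
  have mp : sublinear m /\ forall x, m x <= p x.
    split; last by move=> x; apply: le_trans (mle x q0 Aq0) _; case: (svalP q0).
    split=> [x y|t x t0].
      rewrite -lerBlDr; apply: (gem) => q Aq.
      rewrite lerBlDr [leRHS]addrC -lerBlDr; apply: (gem) => r Ar.
      rewrite lerBlDr.
      (* The smaller of [q] and [r] bounds [m (x + y)], is subadditive, and lies below the other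
         one. *)
      case: (Atot q r Aq Ar) => /asboolP h.
        apply: (le_trans (mle _ r Ar)).
        by have := proj1 (proj1 (svalP r)) x y; have := h x; lra.
      apply: (le_trans (mle _ q Aq)).
      by have := proj1 (proj1 (svalP q)) x y; have := h y; lra.
    rewrite -ler_pdivrMl//; apply: (gem) => q Aq; rewrite ler_pdivrMl//.
    apply: (le_trans (mle _ q Aq)).
    exact: (proj2 (proj1 (svalP q))).
  by exists (exist _ m mp) => q Aq; apply/asboolP => x; exact: mle.
case: g gmin => g [sg gp] gmin.
have gN a : g (- a) = - g a.
  pose q := tilt g a.
  have qT : sublinear q /\ forall x, q x <= p x.
    split; first exact: tilt_sublinear.
    by move=> x; apply: le_trans (gp x); exact: tilt_below.
  have /(congr1 (fun s : T => sval s)) /= qg := gmin (exist _ q qT) ltac:(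
    by apply/asboolP => x; exact: tilt_below).
  have := tilt_opp a sg; rewrite -/q qg => h.
  apply/eqP; rewrite eq_le h /=.
  by have := sublinear_opp a sg; lra.
exists g; split => //.
  move=> x y; apply/eqP; rewrite eq_le (proj1 sg) /=.
  by have := (proj1 sg) (- x) (- y); rewrite -opprD !gN; lra.
move=> t x; have [t0|t0] := leP 0 t; first exact: sublinearZ.
have := @sublinearZ g (- t) x sg; rewrite rmorphN scaleNr gN.
by move=> /(_ ltac:(lra)); lra.
Qed.

(** A linear [g] below the tilt of [p] at [v] satisfies [g (- v) <= - p v], hence [p v <= g v]. *)
Lemma hahn_banach_norming p v : sublinear p -> exists g : V -> R,
  [/\ forall x y, g (x + y) = g x + g y, forall t x, g (rs t *: x) = t * g x,
      forall x, g x <= p x & g v = p v].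
Proof.
move=> sp; have [g [gD gZ gp]] := minimal_sublinear (tilt_sublinear v sp).
have gN : g (- v) = - g v.
  by rewrite -scaleN1r -(rmorphN1 rs) gZ mulN1r.
exists g; split => // [x|].
  exact: le_trans (gp x) (tilt_below _ _ sp).
apply/eqP; rewrite eq_le (le_trans (gp v) (tilt_below _ _ sp))/=.
by have := le_trans (gp (- v)) (tilt_opp v sp); rewrite gN; lra.
Qed.

End hahn_banach.

(** * Real scalars and real-valued norms *)

Section scalars.
Context (R : realType) (k : scalar_kind).
Local Notation K := (scalars R k).

Definition of_real : {rmorphism R -> K} :=
  match k return {rmorphism R -> scalars R k} with
  | RealScalars => (idfun : {rmorphism R -> R})
  | ComplexScalars => (real_complex R : {rmorphism R -> complex R})
  end.

Lemma scalar_reK : cancel of_real (@scalar_re R k).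
Proof. by rewrite /of_real /scalar_re; case: k. Qed.

Lemma ler_of_real : {mono of_real : a b / a <= b}.
Proof. by rewrite /of_real; case: k => a b //=; rewrite lecR. Qed.

(** In the order of [R[i]], a nonnegative number has imaginary part zero. *)
Lemma ge0_scalar (z : K) : 0 <= z -> z = of_real (scalar_re z).
Proof.
rewrite /of_real /scalar_re; case: k z => //= -[a b] /=.
by rewrite lecE /= => /andP[/eqP/= -> _].
Qed.

Lemma scalar_reB : {morph @scalar_re R k : a b / a - b}.
Proof. by rewrite /scalar_re; case: k => //= -[a b] [c d]. Qed.

Section norm.
Variable V : normedModType K.
Implicit Types v w : V.

Lemma normE v : `|v| = of_real (rnorm v).
Proof. exact/ge0_scalar/normr_ge0. Qed.

Lemma rnorm_ge0 v : 0 <= rnorm v.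
Proof. by rewrite -ler_of_real -normE rmorph0. Qed.

Lemma rnormD v w : rnorm (v + w) <= rnorm v + rnorm w.
Proof. by rewrite -ler_of_real rmorphD -!normE ler_normD. Qed.

Lemma rnormN v : rnorm (- v) = rnorm v.
Proof. by rewrite /rnorm normrN. Qed.

Lemma rnorm0 : rnorm (0 : V) = 0.
Proof. by rewrite /rnorm normr0 -(rmorph0 of_real) scalar_reK. Qed.

Lemma rnorm_eq0 v : (rnorm v == 0) = (v == 0).
Proof.
by rewrite -[RHS]normr_eq0 normE -(rmorph0 of_real) (inj_eq (can_inj scalar_reK)).
Qed.

Lemma rnormZ (a : K) v : rnorm (a *: v) = rnorm (a : K^o) * rnorm v.
Proof.
have ha : `|a| = of_real (rnorm (a : K^o)) by exact/ge0_scalar/normr_ge0.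
by rewrite {1}/rnorm normrZ ha normE -rmorphM scalar_reK.
Qed.

Lemma rnorm_of_real t : rnorm (of_real t : K^o) = `|t|.
Proof.
rewrite /rnorm /of_real /scalar_re; case: k => //=.
by rewrite expr0n/= addr0 sqrtr_sqr.
Qed.

Lemma rnormZr t v : rnorm (of_real t *: v) = `|t| * rnorm v.
Proof. by rewrite rnormZ rnorm_of_real. Qed.

Lemma rnorm_sum (I : Type) (r : seq I) (P : pred I) (F : I -> V) :
  rnorm (\sum_(i <- r | P i) F i) <= \sum_(i <- r | P i) rnorm (F i).
Proof.
elim/big_rec2: _ => [|i y z _ h]; first by rewrite rnorm0.
by apply: (le_trans (rnormD _ _)); rewrite lerD2l.
Qed.

Lemma rnorm_sublinear : sublinear of_real (@rnorm R k V).
Proof.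
split; first exact: rnormD.
by move=> t x t0; rewrite rnormZr gtr0_norm.
Qed.

End norm.

Lemma scalar_re_le (z : K^o) : scalar_re z <= rnorm z.
Proof.
rewrite /rnorm /scalar_re; case: k z => [z|[a b]] /=; first exact: ler_norm.
rewrite (le_trans (ler_norm _))//.
by rewrite -sqrtr_sqr ler_wsqrtr// lerDl sqr_ge0.
Qed.
End scalars.
Arguments of_real {R} k.

(** * Bounded functionals and the dual unit ball *)

Section functionals.
Context (R : realType) (k : scalar_kind).
Local Notation K := (scalars R k).

Lemma bounded_functional_continuous (V : normedModType K) (f : {linear V -> K^o})
    (C : R) :
  (forall v, rnorm (f v) <= C * rnorm v) -> continuous f.
Proof.
move=> fC; apply/linear_bounded_continuous/linear_boundedP.
exists (of_real k C); split.
  by rewrite /of_real; case: (k) => /=; rewrite ?num_real// complex_real.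
move=> r Cr v; apply: (@le_trans _ _ (of_real k C * `|v|)).
  by rewrite !normE -rmorphM ler_of_real.
by rewrite ler_wpM2r// ltW.
Qed.

Lemma continuous_functional_bounded (V : normedModType K) (f : {linear V -> K^o}) :
  continuous f -> exists C : R, forall v, rnorm (f v) <= C * rnorm v.
Proof.
move=> /linear_bounded_continuous/linear_boundedP [M [Mr Mf]].
(* The bound [M] lives in [K]; a nonnegative [r] above it is an embedded real and can be read in
   [R]. *)
have [r rM r0] : exists2 r, M < r & 0 <= r.
  exists (`|M| + 1); last by rewrite addr_ge0.
  by rewrite (le_lt_trans (real_ler_norm Mr))// ltrDl.
exists (scalar_re r) => v.
by rewrite -(@ler_of_real R k) rmorphM/= -ge0_scalar// -!normE Mf.
Qed.

Lemma complexify (V : normedModType (complex R)) (g : V -> R) :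
  (forall x y, g (x + y) = g x + g y) ->
  (forall t x, g ((t%:C)%C *: x) = t * g x) ->
  exists f : {linear V -> (complex R)^o}, forall x, complex.Re (f x) = g x.
Proof.
move=> gD gZ.
(* The only complex-linear candidate with real part [g] is [g x - i g (i x)]. *)
pose f x : (complex R)^o := (g x -i* g ('i%C *: x))%C.
have flin : linear f.
  move=> [a b] u v; rewrite /f.
  have e : ((a +i* b) = a%:C + b%:C * 'i :> complex R)%C by simpc.
  have e' : ('i * (a +i* b) = a%:C * 'i + (- b)%:C :> complex R)%C by simpc.
  rewrite scalerDr !gD scalerA [in X in (_ -i* X)%C]e' e !scalerDl !gD -!scalerA !gZ.
  by rewrite /GRing.scale/=; simpc; congr (_ +i* _)%C; ring.
pose F : {linear V -> (complex R)^o} := HB.pack f (GRing.isLinear.Build _ _ _ _ f flin).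
by exists F.
Qed.

Lemma norming_functional (V : normedModType K) (v : V) :
  exists f : {linear V -> K^o},
    (forall x, rnorm (f x) <= rnorm x) /\ scalar_re (f v) = rnorm v.
Proof.
have [g [gD gZ gn gv]] := hahn_banach_norming v (rnorm_sublinear V).
have [f fg] : exists f : {linear V -> K^o}, forall x, scalar_re (f x) = g x.
  rewrite /scalar_re; case: (k) V v g gD gZ gn gv => V v g gD gZ _ _.
    have glin : linear (g : V -> R^o) by move=> a x y; rewrite gD gZ.
    pose F : {linear V -> R^o} := HB.pack g (GRing.isLinear.Build _ _ _ _ g glin).
    by exists F.
  exact: complexify.
exists f; split; last by rewrite fg.
move=> x; have [->|fx0] := eqVneq (f x) 0; first by rewrite rnorm0 rnorm_ge0.
(* So far only the real part of [f] is bounded by the norm. The unimodular factor [u] turns [f x]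
   into its modulus without changing the norm of [x]. *)
pose u : K := of_real k (rnorm (f x)) / (f x).
have fu : f (u *: x) = of_real k (rnorm (f x)).
  by rewrite linearZ/= /GRing.scale/= /u divfK.
have : rnorm (u *: x) = rnorm x.
  rewrite rnormZ (_ : rnorm (u : K^o) = 1) ?mul1r//.
  have := congr1 (fun z : K^o => rnorm z) fu.
  rewrite linearZ/= rnormZ rnorm_of_real ger0_norm ?rnorm_ge0// => h.
  by apply: (@mulIf _ (rnorm (f x))); rewrite ?rnorm_eq0// mul1r.
by move=> <-; rewrite -[leLHS](@scalar_reK R k) -fu fg.
Qed.

Variable X : completeNormedModType K.
Implicit Type f : {linear X -> K^o}.

Lemma rnorm_dual f v : dual f -> rnorm (f v) <= dual_norm f * rnorm v.
Proof.
move=> /continuous_functional_bounded[C fC].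
have [->|v0] := eqVneq v 0; first by rewrite linear0 !rnorm0 mulr0.
have nv : 0 < rnorm v by rewrite lt_def rnorm_eq0 v0 rnorm_ge0.
rewrite -ler_pdivrMr//.
have -> : rnorm (f v) / rnorm v = rnorm (f (of_real k (rnorm v)^-1 *: v)).
  by rewrite linearZ/= rnormZr ger0_norm ?invr_ge0 ?rnorm_ge0// mulrC.
apply: ub_le_sup.
  (* Continuity makes the set bounded, so that its [sup] really is an upper bound. *)
  exists `|C| => _ [w /= w1 <-]; apply: (le_trans (fC w)).
  apply: (@le_trans _ _ (`|C| * rnorm w)).
    by rewrite ler_wpM2r ?rnorm_ge0// ler_norm.
  by rewrite ler_piMr.
exists (of_real k (rnorm v)^-1 *: v) => //=.
by rewrite rnormZr ger0_norm ?invr_ge0 ?rnorm_ge0// mulVf ?gt_eqF.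
Qed.

(** From here on the supremum in [dual_norm] is handled only through this pointwise bound. *)
Lemma dual_ballP f : dual_ball f <-> forall v, rnorm (f v) <= rnorm v.
Proof.
split=> [[df /= f1] v|h].
  apply: (le_trans (rnorm_dual v df)); rewrite -[leRHS]mul1r.
  by rewrite ler_wpM2r ?rnorm_ge0.
split; first by apply: (@bounded_functional_continuous _ _ 1) => v; rewrite mul1r.
rewrite /=; apply: ge_sup; first by exists (rnorm (f 0)); exists 0 => //=; rewrite rnorm0.
by move=> _ [v /= v1 <-]; exact: le_trans (h v) v1.
Qed.

End functionals.

(** * Uniform convexity and Cesaro null sequences *)

Section uniform_convexity.
Context (R : realType) (k : scalar_kind) (X : completeNormedModType (scalars R k)).

Lemma rnorm_normalize (u : X) (r : R) : 0 < rnorm u <= r ->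
  exists2 u' : X, rnorm u' = 1 & rnorm (u - of_real k r *: u') = r - rnorm u.
Proof.
move=> /andP[u0 ur]; exists (of_real k (rnorm u)^-1 *: u).
  by rewrite rnormZr ger0_norm ?invr_ge0 ?rnorm_ge0// mulVf ?gt_eqF.
have -> : u - of_real k r *: (of_real k (rnorm u)^-1 *: u) =
          of_real k (1 - r / rnorm u) *: u.
  by rewrite scalerA -rmorphM rmorphB scalerBl rmorph1 scale1r.
have r1 : 1 - r / rnorm u <= 0 by rewrite subr_le0 ler_pdivlMr// mul1r.
by rewrite rnormZr ler0_norm// opprB mulrBl mul1r divfK ?gt_eqF.
Qed.

(** If [u] has norm at most [r / 2], or one of the norms is at most [(1 - t) * r], the triangle
    inequality suffices. Otherwise both vectors are moved to the sphere of radius [r], each by less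
    than [t * r], and uniform convexity applies there. *)
Lemma uniformly_convex_contraction : uniformly_convex X ->
  exists2 th : R, 0 < th < 1 & forall (r : R) (u v : X), 0 < r ->
    rnorm u <= r -> rnorm v <= r ->
    (r / 2 < rnorm u -> r / 4 <= rnorm (u - v)) ->
    rnorm (u + v) <= 2 * th * r.
Proof.
move=> /(_ 8^-1 ltac:(lra)) [d d0 dP].
(* With [t <= 16^-1], a separation of [r / 4] leaves at least [8^-1] between the unit vectors. With
   [t <= d / 2], the gain [2 * d] outweighs the two errors [t] and the required saving [t]. *)
pose t := Num.min 16^-1 (d / 2).
have t0 : 0 < t by rewrite lt_min; apply/andP; split; lra.
have t16 : t <= 16^-1 by rewrite ge_min lexx.
have td : t <= d / 2 by rewrite ge_min lexx orbT.
exists (1 - t / 2); first lra.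
move=> r u v r0 ur vr uv.
have trr : t * r <= 16^-1 * r by rewrite ler_wpM2r// ltW.
have tdr : t * r <= d / 2 * r by rewrite ler_wpM2r// ltW.
have tr0 : 0 < t * r by rewrite mulr_gt0.
have uvD := rnormD u v.
have [u2|/uv{uv} uv] := leP (rnorm u) (r / 2); first lra.
have [u2|u1] := leP (rnorm u) ((1 - t) * r); first lra.
have [u2|v1] := leP (rnorm v) ((1 - t) * r); first lra.
have [u' u'1 uu'] := @rnorm_normalize u r ltac:(lra).
have [v' v'1 vv'] := @rnorm_normalize v r ltac:(lra).
pose a := u - of_real k r *: u'; pose b := v - of_real k r *: v'.
have h1 : 8^-1 <= rnorm (u' - v').
  rewrite -(ler_pM2l r0) -[r in leRHS]gtr0_norm// -(@rnormZr _ k).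
  have -> : of_real k r *: (u' - v') = (u - v) - (a - b).
    have -> : a - b = (u - v) - (of_real k r *: u' - of_real k r *: v').
      by rewrite /a /b opprD addrACA -opprD.
    by rewrite subKr scalerBr.
  have := rnormD ((u - v) - (a - b)) (a - b); rewrite subrK.
  have := rnormD a (- b); rewrite rnormN uu' vv'; lra.
have := dP _ _ u'1 v'1 h1.
have -> : (2^-1 : scalars R k) = of_real k 2^-1 by rewrite fmorphV rmorph_nat.
rewrite rnormZr ger0_norm ?invr_ge0// => h2.
have -> : u + v = of_real k r *: (u' + v') + (a + b).
  by rewrite scalerDr /a /b (addrACA u) -opprD [RHS]addrC subrK.
have := rnormD (of_real k r *: (u' + v')) (a + b); have := rnormD a b.
rewrite rnormZr gtr0_norm// uu' vv'.
have : r * rnorm (u' + v') <= r * (2 * (1 - d)) by rewrite ler_pM2l//; lra.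
lra.
Qed.
End uniform_convexity.

(** * Sequences with averages tending to zero *)

Section cesaro_null.
Context (R : realType).
Implicit Types phi psi : nat -> R.

(** Convergence to 0 of the averages, cleared of division. *)
Definition cesaro_null phi := forall eta : R, 0 < eta ->
  exists N, forall n, (N <= n)%N -> \sum_(i <- iota 1 n) phi i <= eta * n%:R.

Lemma cesaro_null0 : cesaro_null (fun=> 0).
Proof. by move=> eta eta0; exists 0 => n _; rewrite big1// mulr_ge0// ltW. Qed.

Lemma cesaro_nullD phi psi :
  cesaro_null phi -> cesaro_null psi -> cesaro_null (fun i => phi i + psi i).
Proof.
move=> h1 h2 eta eta0.
have [N1 N1P] := h1 (eta / 2) ltac:(lra).
have [N2 N2P] := h2 (eta / 2) ltac:(lra).
exists (maxn N1 N2) => n; rewrite geq_max => /andP[n1 n2].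
by rewrite big_split/=; have := N1P n n1; have := N2P n n2; lra.
Qed.

Lemma cesaro_null_sum (I : Type) (r : seq I) (phi : I -> nat -> R) :
  (forall j, cesaro_null (phi j)) -> cesaro_null (fun i => \sum_(j <- r) phi j i).
Proof.
move=> h; elim: r => [|j r ih].
  by under [X in cesaro_null X]funext => i do rewrite big_nil; exact: cesaro_null0.
under [X in cesaro_null X]funext => i do rewrite big_cons.
exact: cesaro_nullD.
Qed.

Lemma natr_count (D : pred nat) (s : seq nat) :
  (count D s)%:R = \sum_(i <- s) (D i)%:R :> R.
Proof.
by elim: s => [|i s ih] /=; rewrite ?big_nil// big_cons natrD ih.
Qed.

(** Markov's inequality: at most [e / 2 * n1] indices have [phi i > eta], and fewer than
    [e / 2 * n1] are at most [n0]. The bound [n1] is chosen before [D], which the later induction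
    relies on. *)
Lemma cesaro_null_dense_pick phi (e eta : R) (n0 : nat) :
  (forall i, 0 <= phi i) -> cesaro_null phi -> 0 < e -> 0 < eta ->
  exists2 n1, (n0 <= n1)%N & forall D : pred nat,
    e * n1%:R <= (count D (iota 1 n1))%:R ->
    exists b, [/\ (n0 < b <= n1)%N, D b & phi b <= eta].
Proof.
move=> phi0 phinull e0 eta0.
have [N NP] := phinull (eta * (e / 2)) ltac:(rewrite mulr_gt0//; lra).
have [n2 n2P] : exists n2 : nat, 2 * n0%:R / e < n2%:R :> R.
  by exists (Num.truncn (2 * n0%:R / e)).+1; exact: truncnS_gt.
exists (maxn n0 (maxn N n2)); first by rewrite leq_max leqnn.
set n1 := maxn _ _ => D De; apply: contrapT => nb.
(* If no [b] exists, every element of [D] is either at most [n0] or has [phi i > eta]. *)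
have h i : (i \in iota 1 n1) -> (D i)%:R <= (i <= n0)%N%:R + eta^-1 * phi i.
  rewrite mem_iota add1n ltnS => /andP[i1 in1].
  have [Di|_] := boolP (D i); last first.
    by rewrite addr_ge0// mulr_ge0// invr_ge0 ltW.
  have [i0|i0] := leqP i n0; first by rewrite lerDl mulr_ge0// invr_ge0 ltW.
  rewrite add0r mulrC ler_pdivlMr// mul1r.
  apply: contrapT => /negP; rewrite -ltNge => /ltW ?; apply: nb.
  by exists i; rewrite i0 in1.
have cn0 : (count (fun i => i <= n0) (iota 1 n1) <= n0)%N.
  have -> : n1 = (n0 + (n1 - n0))%N by rewrite subnKC// leq_max leqnn.
  rewrite iotaD count_cat (_ : count _ (iota (1 + n0) _) = 0)%N ?addn0.
    by rewrite (leq_trans (count_size _ _))// size_iota.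
  apply/eqP; rewrite -leqn0 leqNgt -has_count; apply/hasPn => i.
  by rewrite mem_iota add1n -ltnNge => /andP[].
have : (count D (iota 1 n1))%:R <= n0%:R + eta^-1 * \sum_(i <- iota 1 n1) phi i.
  rewrite natr_count mulr_sumr; apply: (@le_trans _ _
    (\sum_(i <- iota 1 n1) ((i <= n0)%N%:R + eta^-1 * phi i))).
    by rewrite big_seq [leRHS]big_seq; apply: ler_sum => i; exact: h.
  by rewrite big_split/= lerD2r -natr_count ler_nat.
have : eta^-1 * \sum_(i <- iota 1 n1) phi i <= e / 2 * n1%:R.
  rewrite mulrC ler_pdivrMr// [leRHS]mulrAC [e / 2 * eta]mulrC.
  by apply: NP; rewrite !leq_max leqnn orbT.
have : n0%:R < e / 2 * n1%:R.
  have : n2%:R <= n1%:R :> R by rewrite ler_nat !leq_max leqnn !orbT.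
  move: n2P; rewrite ltr_pdivrMr// => h1.
  by rewrite -(ler_pM2l e0) => h2; lra.
lra.
Qed.
End cesaro_null.

(** * Blocks with small sums *)

Section sorted_nat.

(** This form allows counting the elements of [s] and reading [s] as a mask of the window. *)
Lemma sorted_ltn_filter (s : seq nat) a n :
  sorted ltn s -> (forall i, i \in s -> (a < i <= a + n)%N) ->
  s = [seq i <- iota a.+1 n | i \in s].
Proof.
move=> ss h; apply: (irr_sorted_eq ltn_trans ltnn ss).
  exact: (sorted_filter ltn_trans _ (iota_ltn_sorted _ _)).
move=> i; rewrite mem_filter mem_iota /= addSn ltnS.
by case: (boolP (i \in s)) => // /h ->.
Qed.

Lemma sorted_ltn_cat (s t : seq nat) n : sorted ltn s -> sorted ltn t ->
  (forall i, i \in s -> (i <= n)%N) -> (forall i, i \in t -> (n < i)%N) ->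
  sorted ltn (s ++ t).
Proof.
move=> ss st sn tn; rewrite !(sorted_pairwise ltn_trans) in ss st *.
rewrite pairwise_cat ss st !andbT; apply/allrelP => i j /sn iN /tn.
exact: leq_ltn_trans.
Qed.

Lemma sorted_ltn_shift (s : seq nat) n :
  sorted ltn s -> sorted ltn [seq (i + n)%N | i <- s].
Proof. by move=> ss; apply: homo_sorted ss => i j; rewrite /= ltn_add2r. Qed.

End sorted_nat.

(** * Passing from density in a window to density on initial segments *)

Section density.
Context (R : realType).

(** Take [m] minimizing the count of [A] in the first [m] places minus [e * m]. Minimality makes [A]
    dense on each stretch starting after [m]. Comparison with [m = 0] shows that at most [e * N]
    elements are lost, so the tail still holds [e * N] of them. *)
Lemma dense_tail (e : R) (A : seq nat) (a N : nat) : 0 < e ->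
  sorted ltn A -> (forall i, i \in A -> (a < i <= a + N)%N) ->
  2 * e * N%:R <= (size A)%:R ->
  exists m, e * N%:R <= (N - m)%N%:R /\
    forall n, (n <= N - m)%N ->
      e * n%:R <= (count (fun i => (i + (a + m))%N \in A) (iota 1 n))%:R.
Proof.
move=> e0 As AN Ae.
pose C m : nat := count (mem A) (iota a.+1 m).
pose g (m : 'I_N.+1) : R := (C m)%:R - e * m%:R.
have [m _ mmin] := @arg_minP _ R _ ord0 xpredT g isT.
have CD j n : C (j + n)%N = (C j + count (fun i => (i + (a + j))%N \in A) (iota 1 n))%N.
  rewrite /C iotaD count_cat; congr (_ + _)%N.
  have -> : (a.+1 + j = (a + j) + 1)%N by lia.
  by rewrite iotaDl count_map; apply: eq_count => i /=; rewrite addnC.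
have mN : (m <= N)%N by rewrite -ltnS.
have CN : C N = size A by rewrite [in RHS](sorted_ltn_filter As AN) size_filter.
exists m; split.
  have := mmin ord0 isT; rewrite /g/= /C/= mulr0 subr0 => h.
  have := CD m (N - m)%N; rewrite subnKC// CN => h'.
  have : (size A)%:R <= (C m)%:R + (N - m)%N%:R :> R.
    by rewrite h' -natrD ler_nat leq_add2l (leq_trans (count_size _ _))// size_iota.
  have : e * m%:R <= e * N%:R by rewrite ler_pM2l// ler_nat.
  by move: h; rewrite -/(C m); lra.
move=> n nN.
have mnN : (m + n < N.+1)%N by lia.
have := mmin (Ordinal mnN) isT.
by rewrite /g/= CD !natrD; lra.
Qed.
End density.

Section selection.
Context (R : realType) (k : scalar_kind) (X : completeNormedModType (scalars R k)).
Variables (x : nat -> X) (M th : R).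
Hypothesis M0 : 0 < M.
Hypothesis xM : forall i, (0 < i)%N -> rnorm (x i) <= M.
Hypothesis th01 : 0 < th < 1.
Hypothesis thP : forall (r : R) (u v : X), 0 < r ->
    rnorm u <= r -> rnorm v <= r ->
    (r / 2 < rnorm u -> r / 4 <= rnorm (u - v)) ->
    rnorm (u + v) <= 2 * th * r.
Hypothesis xwm : forall f : {linear X -> (scalars R k)^o},
  dual f -> cesaro_null (fun i => rnorm (f (x i))).

(* Kakutani's doubling argument: a block of twice the length is obtained by
   choosing the second half almost annihilated by norming functionals of all
   the finitely many possible first halves. *)
Lemma block_selection (q : nat) (e : R) : 0 < e ->
  forall (phi : nat -> R) (eta : R) (n0 : nat),
  (forall i, 0 <= phi i) -> cesaro_null phi -> 0 < eta ->
  exists2 n1, (n0 <= n1)%N & forall D : pred nat,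
    (forall n, (n <= n1)%N -> e * n%:R <= (count D (iota 1 n))%:R) ->
    exists s : seq nat, [/\ sorted ltn s, size s = (2 ^ q)%N,
      forall i, i \in s -> [/\ (n0 < i <= n1)%N, D i & phi i <= eta] &
      rnorm (\sum_(i <- s) x i) <= (2 * th) ^+ q * M].
Proof.
move=> e0; elim: q => [|q ih] phi eta n0 phi0 phinull eta0.
  have [n1 n01 n1P] := cesaro_null_dense_pick n0 phi0 phinull e0 eta0.
  exists n1 => // D /(_ n1 (leqnn _))/n1P[b [bn Db pb]].
  exists [:: b]; split => // [i|]; first by rewrite inE => /eqP->.
  by rewrite big_seq1 expr0 mul1r xM//; case/andP: bn => /(leq_ltn_trans _) ->.
pose r := (2 * th) ^+ q * M.
have r0 : 0 < r by rewrite mulr_gt0// exprn_gt0// mulr_gt0//; case/andP: th01.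
have [n1 n01 n1P] := ih _ _ n0 phi0 phinull eta0.
(* The first half depends on [D], but the final bound must not. Hence a functional is fixed for
   every subset of the first [n1] indices, encoded by its mask. *)
have /choice[F FP] (m : n1.-tuple bool) :
    exists f : {linear X -> (scalars R k)^o},
      (forall v, rnorm (f v) <= rnorm v) /\
      scalar_re (f (\sum_(i <- mask m (iota 1 n1)) x i)) =
        rnorm (\sum_(i <- mask m (iota 1 n1)) x i).
  exact: norming_functional.
pose psi i := phi i + \sum_(m : n1.-tuple bool) rnorm (F m (x i)).
have sum0 i : 0 <= \sum_(m : n1.-tuple bool) rnorm (F m (x i)).
  by apply: sumr_ge0 => m _; exact: rnorm_ge0.
have psi0 i : 0 <= psi i by rewrite addr_ge0.
have psinull : cesaro_null psi.
  apply: cesaro_nullD => //; apply: cesaro_null_sum => m; apply: xwm.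
  by case/dual_ballP: (proj1 (FP m)).
(* The second half has [2 ^ q] terms, so a functional takes a value of norm at most [r / 4] on its
   sum. *)
pose eta' := Num.min eta (r / 4 / (2 ^ q)%N%:R).
have q0 : 0 < (2 ^ q)%N%:R :> R by rewrite ltr0n expn_gt0.
have eta'0 : 0 < eta' by rewrite lt_min eta0 !divr_gt0.
have [n2 n12 n2P] := ih _ _ n1 psi0 psinull eta'0.
exists n2; first exact: leq_trans n12.
move=> D DP.
(* Density on all initial segments lets the same [D] serve at both scales [n1] and [n2]. *)
have [s [ss sq sP sr]] := n1P D (fun n h => DP n (leq_trans h n12)).
have [t [ts tq tP tr]] := n2P D DP.
exists (s ++ t); split.
- apply: (@sorted_ltn_cat _ _ n1) => // [i /sP[/andP[]]//|i /tP[/andP[]]//].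
- by rewrite size_cat sq tq expnS mul2n addnn.
- move=> i; rewrite mem_cat => /orP[/sP[/andP[i1 i2] ? ?]|].
    by split=> //; rewrite i1 (leq_trans i2).
  move=> /tP[/andP[i1 i2] Di hi]; split => //.
    by rewrite i2 (leq_ltn_trans n01).
  apply: le_trans (_ : eta' <= _); last by rewrite ge_min lexx.
  by apply: le_trans hi; rewrite lerDl.
rewrite big_cat exprS -mulrA -/r.
(* The functional norming the first sum [u] gives [|u - v| >= |u| - r / 4 > r / 4], where [v] is the
   second sum. *)
apply: thP => // u2.
have /subseqP[m mn sm] : subseq s (iota 1 n1).
  rewrite (@sorted_ltn_filter s 0 n1)//; first exact: filter_subseq.
  by move=> i /sP[/andP[h1 h2] _ _]; rewrite h2 (leq_ltn_trans _ h1).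
have ms : size m == n1 by rewrite mn size_iota.
pose m' : n1.-tuple bool := Tuple ms; pose f := F m'.
have [Fle] := FP m'; rewrite /= -sm -/f => Fs.
have ft : rnorm (f (\sum_(i <- t) x i)) <= r / 4.
  rewrite linear_sum; apply: (le_trans (rnorm_sum _ _ _)).
  apply: (@le_trans _ _ (\sum_(i <- t) (r / 4 / (2 ^ q)%N%:R))).
    rewrite big_seq [leRHS]big_seq; apply: ler_sum => i /tP[_ _ hi].
    apply: le_trans (_ : eta' <= _); last by rewrite ge_min lexx orbT.
    apply: le_trans hi; rewrite /psi /f (bigD1 m')//=.
    by rewrite addrCA lerDl addr_ge0// sumr_ge0// => *; exact: rnorm_ge0.
  rewrite big_const_seq count_predT tq iter_addr_0.
  by rewrite -(mulr_natr (r / 4 / _)) divfK ?gt_eqF.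
apply: le_trans (Fle _); apply: le_trans (scalar_re_le _).
rewrite linearB scalar_reB Fs.
have := scalar_re_le (f (\sum_(i <- t) x i)); move: u2 ft; lra.
Qed.

Hypothesis c_shift : exists2 c : R, 1 <= c & forall (s : seq nat) (n : nat),
  sorted ltn s -> (forall i, i \in s -> (0 < i)%N) ->
  rnorm (\sum_(i <- s) x (i + n)%N) <= c * rnorm (\sum_(i <- s) x i).

Lemma dense_small_subblock (e d : R) : 0 < e -> 0 < d ->
  exists N0 : nat, forall (N a : nat) (A : seq nat), (N0 <= N)%N ->
    sorted ltn A -> (forall i, i \in A -> (a < i <= a + N)%N) ->
    e * N%:R <= (size A)%:R ->
    exists P : seq nat, [/\ sorted ltn P, {subset P <= A}, (0 < size P)%N &
      rnorm (\sum_(i <- P) x i) <= d * (size P)%:R].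
Proof.
move=> e0 d0; have [c c1 cP] := c_shift; have /andP[th0 th1] := th01.
have e20 : 0 < e / 2 by lra.
(* The factor [c] is the later cost of shifting the block into [A]. *)
have [q qP] : exists q : nat, th ^+ q * M * c <= d.
  have /cvgrPdist_lt/(_ (d / (M * c))) : th ^+ n @[n --> \oo] --> (0 : R).
    by apply: cvg_expr; rewrite gtr0_norm; lra.
  move=> /(_ ltac:(by rewrite divr_gt0// mulr_gt0//; lra)) [q _ /(_ q (leqnn _))].
  rewrite sub0r normrN normrX gtr0_norm; last lra.
  rewrite ltr_pdivlMr ?mulr_gt0//; last lra.
  by rewrite mulrA => h; exists q; exact: ltW.
(* No extra smallness is imposed on the block, so [phi] is zero; [n0 = 0] makes its indices
   positive. *)
have [L _ LP] := @block_selection q (e / 2) e20 _ 1 0 (fun=> lexx _)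
  (@cesaro_null0 R) ltr01.
have [N0 N0P] : exists N0 : nat, L%:R / (e / 2) < N0%:R :> R.
  by exists (Num.truncn (L%:R / (e / 2))).+1; exact: truncnS_gt.
exists N0 => N a A N0N As AN Ae.
(* The tail has length at least [e / 2 * N >= L], enough room for a block. *)
have [m [mN mP]] := @dense_tail R (e / 2) A a N e20 As AN ltac:(lra).
have LN : (L <= N - m)%N.
  rewrite -(ler_nat R); apply: le_trans mN.
  rewrite -ler_pdivrMl// mulrC; apply: (le_trans (ltW N0P)).
  by rewrite ler_nat.
have [s [ss sq sP sr]] := LP _ (fun n h => mP n (leq_trans h LN)).
exists [seq (i + (a + m))%N | i <- s]; split.
- exact: sorted_ltn_shift.
- by move=> _ /mapP[i /sP[_ ? _] ->].
- by rewrite size_map sq expn_gt0.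
rewrite big_map size_map sq.
apply: (le_trans (cP _ _ ss _)); first by move=> i /sP[/andP[]].
apply: (@le_trans _ _ (c * ((2 * th) ^+ q * M))); first by rewrite ler_pM2l//; lra.
rewrite exprMn natrX; have : 0 < 2 ^+ q :> R by rewrite exprn_gt0.
move=> h; rewrite (_ : c * _ = 2 ^+ q * (th ^+ q * M * c)); last by ring.
by rewrite [leRHS]mulrC ler_pM2l.
Qed.

(* Greedily remove small blocks until the remaining set has small density. *)
Lemma window_sums_small (e : R) : 0 < e ->
  exists N0 : nat, forall (N a : nat) (A : seq nat), (N0 <= N)%N ->
    sorted ltn A -> (forall i, i \in A -> (a < i <= a + N)%N) ->
    rnorm (\sum_(i <- A) x i) <= e * N%:R.
Proof.
move=> e0; have e20 : 0 < e / 2 by lra.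
(* Below density [e / 2 / M] the bound [M] on each term gives at most [e / 2 * N]. *)
have [N0 N0P] := @dense_small_subblock (e / 2 / M) (e / 2)
  ltac:(by rewrite divr_gt0) e20.
exists N0 => N a A N0N.
(* The term with [N] pays for the sparse remainder, the term with [size B] for the removed blocks.
   Since [size A <= N], the total is at most [e * N]. *)
suff h (n : nat) (B : seq nat) : (size B <= n)%N -> sorted ltn B ->
    (forall i, i \in B -> (a < i <= a + N)%N) ->
    rnorm (\sum_(i <- B) x i) <= e / 2 * N%:R + e / 2 * (size B)%:R.
  move=> As AN; apply: (le_trans (h (size A) A _ As AN)) => //.
  have : (size A)%:R <= N%:R :> R.
    rewrite ler_nat (sorted_ltn_filter As AN) size_filter.
    by rewrite (leq_trans (count_size _ _))// size_iota.
  by rewrite -(ler_pM2l e20); lra.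
elim: n B => [|n ih] B Bn Bs BN.
  move: Bn; rewrite leqn0 => /nilP->; rewrite big_nil rnorm0 mulr0 addr0.
  by rewrite mulr_ge0// ltW.
have [Bsmall|Bbig] := ltP (size B)%:R (e / 2 / M * N%:R).
  apply: (@le_trans _ _ (M * (size B)%:R)).
    apply: (le_trans (rnorm_sum _ _ _)).
    rewrite (_ : M * _ = \sum_(i <- B) M); last first.
      by rewrite big_const_seq count_predT iter_addr_0 mulr_natr.
    rewrite big_seq [leRHS]big_seq; apply: ler_sum => i /BN/andP[i0 _].
    by rewrite xM// (leq_ltn_trans _ i0).
  have : M * (size B)%:R <= e / 2 * N%:R.
    rewrite -ler_pdivlMl//; apply: (le_trans (ltW Bsmall)).
    by rewrite mulrA [e / 2 / M]mulrC.
  have : 0 <= e / 2 * (size B)%:R by rewrite mulr_ge0// ltW.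
  lra.
have [P [Ps PB P0 Pd]] := N0P N a B N0N Bs BN Bbig.
have Bu := sorted_uniq ltn_trans ltnn Bs.
have Pu := sorted_uniq ltn_trans ltnn Ps.
pose B' := [seq i <- B | i \notin P].
have BP : perm_eq B (P ++ B').
  rewrite -(perm_filterC (mem P) B) perm_cat2r.
  apply: uniq_perm; rewrite ?filter_uniq// => i; rewrite mem_filter /=.
  by have [/PB|] := boolP (i \in P).
have sB : size B = (size P + size B')%N by rewrite (perm_size BP) size_cat.
have B'n : (size B' <= n)%N.
  by rewrite -ltnS (leq_trans _ Bn)// sB -[ltnLHS]add0n ltn_add2r.
rewrite (perm_big _ BP) big_cat sB natrD.
apply: (le_trans (rnormD _ _)).
have := ih B' B'n (sorted_filter ltn_trans _ Bs) ltac:(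
  by move=> i; rewrite mem_filter => /andP[_ /BN]).
rewrite /=; lra.
Qed.

End selection.

(** * Mixing conditions *)

Section subset_sums.
Context (R : realType) (k : scalar_kind).

(** The nonnegative and the negative terms each form a subset sum. *)
Lemma sum_normr_le_subset (I : Type) (s : seq I) (g : I -> R) (B : R) :
  (forall P : pred I, `|\sum_(i <- s | P i) g i| <= B) ->
  \sum_(i <- s) `|g i| <= 2 * B.
Proof.
move=> h; rewrite (bigID (fun i => 0 <= g i))/=.
have -> : \sum_(i <- s | 0 <= g i) `|g i| = \sum_(i <- s | 0 <= g i) g i.
  by apply: eq_bigr => i gi; rewrite ger0_norm.
have -> : \sum_(i <- s | ~~ (0 <= g i)) `|g i| =
          - \sum_(i <- s | ~~ (0 <= g i)) g i.
  by rewrite -sumrN; apply: eq_bigr => i; rewrite -ltNge => gi; rewrite ltr0_norm.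
rewrite mulr_natl mulr2n lerD//.
  exact: le_trans (ler_norm _) (h _).
by apply: le_trans (ler_norm _) _; rewrite normrN.
Qed.

(** For complex scalars, real and imaginary parts contribute [2 * B] each. *)
Lemma sum_rnorm_le_subset (I : Type) (s : seq I) (z : I -> (scalars R k)^o) (B : R) :
  (forall P : pred I, rnorm (\sum_(i <- s | P i) z i) <= B) ->
  \sum_(i <- s) rnorm (z i) <= 4 * B.
Proof.
rewrite /rnorm /scalar_re; case: k z => z h.
  apply: le_trans (sum_normr_le_subset h) _.
  by rewrite ler_wpM2r ?ler_nat// (le_trans _ (h xpredT)).
have normE (w : complex R) : complex.Re `|w : (complex R)^o| =
    Num.sqrt (complex.Re w ^+ 2 + complex.Im w ^+ 2) by case: w.
have re_le (w : complex R) : `|complex.Re w| <= complex.Re `|w : (complex R)^o|.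
  by rewrite normE -sqrtr_sqr ler_wsqrtr// lerDl sqr_ge0.
have im_le (w : complex R) : `|complex.Im w| <= complex.Re `|w : (complex R)^o|.
  by rewrite normE -sqrtr_sqr ler_wsqrtr// lerDr sqr_ge0.
have le_reim (w : complex R) :
    complex.Re `|w : (complex R)^o| <= `|complex.Re w| + `|complex.Im w|.
  rewrite normE -(@ler_pXn2r _ 2) ?nnegrE ?sqrtr_ge0 ?addr_ge0//.
  rewrite sqr_sqrtr ?addr_ge0 ?sqr_ge0// sqrrD !real_normK ?num_real//.
  by rewrite addrAC lerDl mulrn_wge0// mulr_ge0.
have hre : \sum_(i <- s) `|complex.Re (z i)| <= 2 * B.
  apply: sum_normr_le_subset => P; apply: le_trans (h P).
  by rewrite -raddf_sum; exact: re_le.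
have him : \sum_(i <- s) `|complex.Im (z i)| <= 2 * B.
  apply: sum_normr_le_subset => P; apply: le_trans (h P).
  by rewrite -raddf_sum; exact: im_le.
apply: (@le_trans _ _ (\sum_(i <- s) (`|complex.Re (z i)| + `|complex.Im (z i)|))).
  by apply: ler_sum => i _; exact: le_reim.
by rewrite big_split/=; lra.
Qed.

End subset_sums.

#[global] Instance gap_infty_filter : Filter gap_infty.
Proof.
apply: filter_from_filter; first by exists 0.
move=> i j _ _; exists (i + j) => // -[a b] /= [a0 ab].
by split; split => //=; apply: leq_trans ab; lia.
Qed.

Section equivalences.
Context (R : realType) (k : scalar_kind) (X : completeNormedModType (scalars R k)).
Variable x : nat -> X.
Hypothesis xcsb : cesaro_shift_bounded x.

(** Increasing index maps become sorted lists; raising the constant to at least 1 covers the shift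
    by 0. *)
Lemma shift_bounded_seq : exists2 c : R, 1 <= c & forall (s : seq nat) (n : nat),
  sorted ltn s -> (forall i, i \in s -> (0 < i)%N) ->
  rnorm (\sum_(i <- s) x (i + n)%N) <= c * rnorm (\sum_(i <- s) x i).
Proof.
case: xcsb => c c0 cP; exists (Num.max c 1); first by rewrite le_max lexx orbT.
move=> s n ss s0; have [->|n0] := posnP n.
  under eq_bigr do rewrite addn0.
  by rewrite ler_peMl ?rnorm_ge0// le_max lexx orbT.
have [->|sN0] := eqVneq s [::]; first by rewrite !big_nil rnorm0 mulr0.
have sz : (0 < size s)%N by case: (s) sN0.
apply: (@le_trans _ _ (c * rnorm (\sum_(i <- s) x i))); last first.
  by rewrite ler_wpM2r ?rnorm_ge0// le_max lexx.
have nthE (F : nat -> X) : \sum_(i <- s) F i = \sum_(j < size s) F (nth 0 s j).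
  by rewrite (big_nth 0) big_mkord.
rewrite !nthE.
apply: (cP _ (fun j : 'I_(size s) => nth 0 s j)) => //.
  by move=> j; apply/s0/mem_nth.
by move=> i j ij; apply: (sorted_ltn_nth ltn_trans) => //; rewrite inE.
Qed.

(** Each term is a shift of [x 1]; adding 1 keeps [M] positive even if [x 1 = 0]. *)
Lemma shift_bounded_bounded : exists2 M : R, 0 < M &
  forall i, (0 < i)%N -> rnorm (x i) <= M.
Proof.
have [c c1 cP] := shift_bounded_seq; exists (c * rnorm (x 1) + 1).
  by rewrite ltr_wpDl// mulr_ge0 ?rnorm_ge0//; lra.
case=> // i _; have := cP [:: 1%N] i isT ltac:(by move=> j; rewrite inE => /eqP->).
by rewrite !big_seq1 add1n; lra.
Qed.

Lemma weakly_mixing_cesaro_null : weakly_mixing_to_zero x ->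
  forall f : {linear X -> (scalars R k)^o}, dual f ->
  cesaro_null (fun i => rnorm (f (x i))).
Proof.
move=> wm f /wm /cvgrPdist_lt h eta /h [N _ NP].
exists (maxn N 1) => n; rewrite geq_max => /andP[/NP/= Nn n0].
move: Nn; rewrite sub0r normrN => /(le_lt_trans (ler_norm _)).
rewrite mulrC ltr_pdivrMr ?ltr0n// => /ltW.
by rewrite /index_iota subn1.
Qed.

Let ball_sums_ub (r : R) (s : seq nat) : 0 <= r ->
  has_ubound [set r * \sum_(i <- s) rnorm (f (x i)) | f in @dual_ball R k X].
Proof.
move=> r0; exists (r * \sum_(i <- s) rnorm (x i)) => _ [f /dual_ballP fb <-].
by rewrite ler_wpM2l// ler_sum.
Qed.

Lemma zero_dual_ball : dual_ball (\0 : {linear X -> (scalars R k)^o}).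
Proof. by apply/dual_ballP => v; rewrite rnorm0 rnorm_ge0. Qed.

(** The zero functional makes the set nonempty and its supremum nonnegative. *)
Let ball_sup_le (r B : R) (s : seq nat) : 0 <= r ->
  (forall f : {linear X -> (scalars R k)^o}, dual_ball f ->
     r * \sum_(i <- s) rnorm (f (x i)) <= B) ->
  `|sup [set r * \sum_(i <- s) rnorm (f (x i)) | f in @dual_ball R k X]| <= B.
Proof.
move=> r0 h; rewrite ger0_norm.
  apply: ge_sup; last by move=> _ [f fb <-]; exact: h.
  by eexists; exists \0 => //; exact: zero_dual_ball.
pose z : {linear X -> (scalars R k)^o} := \0.
apply: (@le_trans _ _ (r * \sum_(i <- s) rnorm (z (x i)))).
  by rewrite mulr_ge0// sumr_ge0// => *; exact: rnorm_ge0.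
by apply: ub_le_sup; [exact: ball_sums_ub|exists \0 => //; exact: zero_dual_ball].
Qed.

Lemma weakly_mixing_window : uniformly_convex X ->
  weakly_mixing_to_zero x -> window_uniformly_weakly_mixing_to_zero x.
Proof.
move=> uc wm; have [M M0 xM] := shift_bounded_bounded.
have [th th01 thP] := uniformly_convex_contraction uc.
have small := window_sums_small M0 xM th01 thP
  (weakly_mixing_cesaro_null wm) shift_bounded_seq.
apply/cvgrPdist_le => e e0.
(* The quarter compensates the factor 4 of [sum_rnorm_le_subset]. *)
have [N0 N0P] := small (e / 4) ltac:(lra).
exists N0 => // -[a b] /= [a0 ab].
rewrite sub0r normrN.
have -> : b%:R - a%:R + 1 = (b.+1 - a)%N%:R :> R.
  by rewrite natrB; [rewrite -natr1; lra|lia].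
have n0 : 0 < (b.+1 - a)%N%:R :> R by rewrite ltr0n; lia.
apply: ball_sup_le => [|f /dual_ballP fb]; first by rewrite invr_ge0 ltW.
rewrite ler_pdivrMl//.
apply: le_trans (_ : 4 * (e / 4 * (b.+1 - a)%N%:R) <= _); last lra.
apply: sum_rnorm_le_subset => P.
rewrite -linear_sum; apply: (le_trans (fb _)); rewrite -big_filter.
(* The half-open window after [a.-1] of length [b.+1 - a] is the closed one from [a] to [b], as
   [a > 0]. *)
apply: (N0P _ a.-1); first lia.
  exact: (sorted_filter ltn_trans _ (iota_ltn_sorted _ _)).
by move=> i; rewrite mem_filter mem_index_iota => /andP[_ ?]; lia.
Qed.

Lemma window_uniformly : window_uniformly_weakly_mixing_to_zero x ->
  uniformly_weakly_mixing_to_zero x.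
Proof.
move=> /cvgrPdist_lt h; apply/cvgrPdist_lt => e /h [N _ NP].
(* The window from 1 to [n] has gap [n - 1], whence [N.+1]. *)
exists N.+1 => // n /= Nn; have := NP (1, n) ltac:(by split => //=; lia).
by rewrite /= subrK.
Qed.

(** Dividing [f] by a positive bound of its norm puts it in the dual ball. *)
Lemma uniformly_weakly : uniformly_weakly_mixing_to_zero x ->
  weakly_mixing_to_zero x.
Proof.
move=> /cvgrPdist_lt h f df; apply/cvgrPdist_lt => e e0.
have [C fC] := continuous_functional_bounded df.
pose r := `|C| + 1.
have r0 : 0 < r by rewrite ltr_wpDl.
pose g : {linear X -> (scalars R k)^o} := of_real k r^-1 \*: f.
have gE v : rnorm (g v) = r^-1 * rnorm (f v).
  by rewrite /= rnormZr ger0_norm// invr_ge0 ltW.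
have gb : dual_ball g.
  apply/dual_ballP => v; rewrite gE ler_pdivrMl//; apply: (le_trans (fC v)).
  rewrite ler_wpM2r ?rnorm_ge0//; apply: (le_trans (ler_norm _)).
  by rewrite lerDl.
have [N _ NP] := h (e / r) ltac:(by rewrite divr_gt0).
exists N => // n /NP/=; rewrite !sub0r !normrN => /(le_lt_trans (ler_norm _)).
rewrite ger0_norm; last first.
  by rewrite mulr_ge0 ?invr_ge0// sumr_ge0// => *; exact: rnorm_ge0.
rewrite ltr_pdivlMr//; apply: le_lt_trans.
rewrite -ler_pdivrMr//; apply: ub_le_sup; first exact: ball_sums_ub.
exists g => //; rewrite -mulrA; congr (_ * _).
by rewrite mulr_suml; apply: eq_bigr => i _; rewrite gE mulrC.
Qed.

End equivalences.

Theorem theorem6p3 (R : realType) (k : scalar_kind)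
    (X : completeNormedModType (scalars R k)) (x : nat -> X)
    (hX : uniformly_convex X) (hx : cesaro_shift_bounded x) :
  (weakly_mixing_to_zero x <-> uniformly_weakly_mixing_to_zero x) /\
  (uniformly_weakly_mixing_to_zero x <->
     window_uniformly_weakly_mixing_to_zero x).
Proof.
(* The cycle from (i) to (jw) to (j) and back to (i) yields both equivalences. *)
have iw := weakly_mixing_window hx hX.
have wu := @window_uniformly R k X x; have ui := @uniformly_weakly R k X x.
by split; split; auto.
Qed.
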